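(* Let $X^{n,s}$ denote the final outcome of the match-and-add-over rolling scheme with $n$ dice, each having $s$ sides. Then $$\mathbb{E}\left(X^{3,6}\right) = \frac{54}{5} \quad\text{and}\quad \mathbb{E}\left(X^{2,6}\right) = \frac{42}{5}.$$
   Context: Let $n \in \mathbb{N}=\{0,1,2,\dots\}$ and $s \in \mathbb{Z}_+=\{1,2,\dots\}$ be fixed. On a probability space $(\Omega,\mathbb{P})$ let $Z_j^l$, for $j \in \mathbb{Z}_+$ and $l \in \{1,\dots,n\}$, be mutually independent random variables, each uniformly distributed on $\{1,\dots,s\}$: $\mathbb{P}(Z_j^l = m) = 1/s$ for every $m \in \{1,\dots,s\}$. Here $Z_j^l$ is the value of the $l$-th die in the $j$-th set of rolls. Let $M_0 = \Omega$ and, for $j \ge 1$, let $M_j = \{\omega \in \Omega : Z_j^1(\omega) = Z_j^2(\omega) = \cdots = Z_j^n(\omega)\}$ (the event that the $j$-th set of rolls is a match). Define $X_0 = 0$ and, for $j \ge 1$, $$X_j(\omega) = \begin{cases} X_{j-1}(\omega) + \sum_{l=1}^n Z_j^l(\omega) & \text{if } \omega \in \bigcap_{k=0}^{j-1} M_k,\\ X_{j-1}(\omega) & \text{otherwise.}\end{cases}$$ The final outcome of the rolling scheme is $X^{n,s} = \lim_{j\to\infty} X_j$ (a nondecreasing limit, with values in $[0,\infty]$). $\mathbb{E}$ denotes expectation. *)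

(* Defs.v *)
From mathcomp Require Import all_boot all_order all_algebra.
From mathcomp Require Import finmap.
From mathcomp Require Import all_classical all_reals all_analysis.

Set Implicit Arguments.
Unset Strict Implicit.
Unset Printing Implicit Defensive.

Import Order.TTheory GRing.Theory Num.Theory.
Import numFieldNormedType.Exports.

Local Open Scope classical_set_scope.
Local Open Scope ring_scope.

(* The product rule over all finite subfamilies. *)
Definition mutually_independent d (T : measurableType d) (R : realType)
    (P : probability T R) d' (T' : measurableType d') (I : choiceType)
    (X : I -> {RV P >-> T'}) : Prop :=
  forall (J : {fset I}) (A : I -> set T'),
    (forall i, i \in J -> measurable (A i)) ->
    P (\bigcap_(i in [set` J]) (X i @^-1` A i)) =
    (\prod_(i <- enum_fset J) P (X i @^-1` A i))%E.

Definition uniform_die d (T : measurableType d) (R : realType)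
    (P : probability T R) (s : nat) (Y : {RV P >-> nat}) : Prop :=
  forall m : nat, (1 <= m <= s)%N -> P (Y @^-1` [set m]) = (s%:R^-1)%:E.

(* Sets of rolls are numbered from 1 on paper and from 0 here: [Z j l] is the
   value of die [l] in the set of rolls number [j.+1]. *)
Definition fair_dice d (T : measurableType d) (R : realType)
    (P : probability T R) (n s : nat)
    (Z : nat -> 'I_n -> {RV P >-> nat}) : Prop :=
  mutually_independent (fun jl : nat * 'I_n => Z jl.1 jl.2) /\
  forall j l, uniform_die s (Z j l).

Section match_and_add_over.
Context d (T : measurableType d) (R : realType) (P : probability T R) (n : nat).
Variable Z : nat -> 'I_n -> {RV P >-> nat}.

(* M_0 is the whole space; M_j, for j >= 1, is about the j-th set of rolls. *)
Definition match_event (j : nat) : set T :=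
  if j is i.+1 then [set w | forall l l' : 'I_n, Z i l w = Z i l' w]
  else setT.

Fixpoint partial_outcome (j : nat) (w : T) : nat :=
  if j is i.+1 then
    if w \in \bigcap_(k < i.+1) match_event k
    then (partial_outcome i w + \sum_(l < n) Z i l w)%N
    else partial_outcome i w
  else 0%N.

(* The limit is taken in the extended reals, as it may be +oo. *)
Definition final_outcome (w : T) : \bar R :=
  limn (fun j => ((partial_outcome j w)%:R)%:E).

(* ['E_P[_]] is restricted to real-valued functions, for which it is this
   integral. *)
Definition expected_outcome : \bar R := (\int[P]_w final_outcome w)%E.

End match_and_add_over.

(* Main.v *)
Require Import Defs.
From mathcomp Require Import all_boot all_order all_algebra.
From mathcomp Require Import finmap.
From mathcomp Require Import all_classical all_reals all_analysis.
From mathcomp Require Import measurable_realfun ring.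

(** Call [q = s^(1-n)] the probability that one set of rolls is a match. Since
    a uniform die lies in [{1, ..., s}] almost surely, conditioning on the value
    of one die of the set shows that the event that the first [j] sets of rolls
    all match has probability [q^j], and is independent of the value of any die
    of set [j+1]. Hence the expected contribution of set [j+1] is
    [q^j n (s+1)/2]; summing over [j] gives [n (s+1)/2 / (1 - q)]. *)

Set Implicit Arguments.
Unset Strict Implicit.
Unset Printing Implicit Defensive.

Import Order.TTheory GRing.Theory Num.Theory.
Import numFieldNormedType.Exports.

Local Open Scope classical_set_scope.
Local Open Scope ring_scope.

(** * Splitting an integral along the values of a uniform die *)

Section uniform_die.

Context d (T : measurableType d) (R : realType) (P : probability T R).

Lemma measurable_RV_preimage (Y : {RV P >-> nat}) (A : set nat) :
  measurable (Y @^-1` A).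
Proof. by rewrite -[_ @^-1` _]setTI; exact: measurable_funPT. Qed.

(** The events that [Y] equals [1], ..., [s] are disjoint and each has probability [1/s], so their
    union [D] has probability 1 and its complement does not affect the integral. *)
Lemma uniform_die_integral (s : nat) (Y : {RV P >-> nat}) (f : T -> \bar R) :
  (0 < s)%N -> uniform_die s Y -> measurable_fun setT f ->
  (forall w, (0 <= f w)%E) ->
  (\int[P]_w f w = \sum_(m < s) \int[P]_(w in Y @^-1` [set m.+1]) f w)%E.
Proof.
move=> s0 uY mf f0.
pose F (m : 'I_s) := Y @^-1` [set m.+1].
have mF m : measurable (F m) by exact: measurable_RV_preimage.
have tF : trivIset [set` index_enum 'I_s] F.
  move=> i j _ _ [w [/= Yi Yj]]; apply/val_inj/succn_inj.
  by rewrite -Yi -Yj.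
pose D := \big[setU/set0]_(m < s) F m.
have mD : measurable D by apply: bigsetU_measurable => m _; exact: mF.
have sumD (g : T -> \bar R) : measurable_fun setT g ->
    (forall w, (0 <= g w)%E) ->
    (\int[P]_(w in D) g w = \sum_(m < s) \int[P]_(w in F m) g w)%E.
  move=> mg g0; apply: ge0_integral_bigsetU => //.
  - exact: index_enum_uniq.
  - exact: measurable_funS mg.
have PD : P D = 1%E.
  (* Additivity over the pieces of [D], applied to the constant 1, computes [P D]. *)
  have /= := sumD (cst 1%E) (measurable_cst _) (fun=> lee01).
  rewrite integral_cst // mul1e => ->.
  rewrite (eq_bigr (fun=> (s%:R^-1)%:E)); last first.
    by move=> m _; rewrite integral_cst // mul1e; apply: uY => /=.
  rewrite sumEFin sumr_const card_ord -[RHS]/(1%:E); congr EFin.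
  by rewrite -[LHS]mulr_natr mulVf // pnatr_eq0 -lt0n.
have PDC : P (~` D) = 0%E by rewrite probability_setC // PD subee.
rewrite -sumD // -[D]setCK -setTD.
exact: (@ge0_negligible_integral _ _ _ _ _ (~` D) _ (measurableC mD)).
Qed.

Lemma uniform_die_probability (s : nat) (Y : {RV P >-> nat}) (B : set T) :
  (0 < s)%N -> uniform_die s Y -> measurable B ->
  (P B = \sum_(m < s) P (B `&` Y @^-1` [set m.+1]))%E.
Proof.
move=> s0 uY mB; rewrite -[in LHS](setIT B) -integral_indic //.
rewrite (uniform_die_integral s0 uY).
- by apply: eq_bigr => m _; rewrite integral_indic //;
    exact: measurable_RV_preimage.
- by apply/measurable_EFinP; exact: measurable_indic.
- by move=> w; rewrite lee_fin.
Qed.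

End uniform_die.

Section match_and_add_over.

Context d (T : measurableType d) (R : realType) (P : probability T R).
(* There are [n.+1] dice, so a set of rolls matches with probability [s^-n]. *)
Context (n s : nat) (Z : nat -> 'I_n.+1 -> {RV P >-> nat}).
Hypothesis s_gt0 : (0 < s)%N.
Hypothesis fairZ : fair_dice s Z.

(** * Events prescribing the values of finitely many dice *)

Let roll_set (j : nat) : seq (nat * 'I_n.+1) :=
  [seq (j, l) | l <- enum 'I_n.+1].

Definition dice_values (K : seq (nat * 'I_n.+1)) (v : nat * 'I_n.+1 -> nat) :
  set T := [set w | forall k, k \in K -> Z k.1 k.2 w = v k].

Lemma dice_valuesE K v :
  dice_values K v = \bigcap_(k in [set` K]) (Z k.1 k.2 @^-1` [set v k]).
Proof. by []. Qed.

Lemma measurable_dice_values K v : measurable (dice_values K v).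
Proof.
rewrite dice_valuesE bigcap_seq; apply: bigsetI_measurable => k _.
exact: measurable_RV_preimage.
Qed.

Lemma dice_values_cat K K' v :
  dice_values (K ++ K') v = dice_values K v `&` dice_values K' v.
Proof.
apply/seteqP; split => [w vw|w [vw vw'] k].
  by split=> k kK; apply: vw; rewrite mem_cat kK ?orbT.
by rewrite mem_cat => /orP[/vw|/vw'].
Qed.

Lemma eq_dice_values K v v' : {in K, v =1 v'} ->
  dice_values K v = dice_values K v'.
Proof.
by move=> vv'; apply/seteqP; split => w vw k kK; have := vw k kK; rewrite vv'.
Qed.

Lemma probability_dice_values K v : uniq K ->
  (forall k, k \in K -> (0 < v k <= s)%N) ->
  P (dice_values K v) = ((s%:R^-1) ^+ size K)%:E.
Proof.
move=> uK vK; have [indZ uniZ] := fairZ.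
have /= := indZ [fset x in K]%fset (fun k => [set v k]) (fun _ _ => I).
rewrite (_ : [set` _] = [set` K]); last first.
  by apply/seteqP; split=> k; rewrite /= in_fset.
rewrite -dice_valuesE => ->.
rewrite big_seq (eq_bigr (fun=> (s%:R^-1)%:E)); last first.
  by move=> k; rewrite in_fset => kK; rewrite uniZ ?vK.
rewrite -big_seq prodEFin big_const_seq iter_mulr_1 count_predT.
by have := card_fseq K; rewrite (undup_id uK) => <-.
Qed.

(** * Probability that the first sets of rolls all match *)

Definition all_match (j : nat) : set T :=
  \bigcap_(k < j.+1) match_event Z k.

Lemma all_match0 : all_match 0 = setT.
Proof. by apply/seteqP; split=> // w _ [|i]. Qed.

Lemma all_matchS j : all_match j.+1 = all_match j `&` match_event Z j.+1.
Proof.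
apply/seteqP; split => [w aw|w [aw mw] k /=].
  by split=> [k /= kj|]; apply: aw => //=; exact: leqW.
by rewrite ltnS leq_eqVlt => /predU1P[->//|kj]; exact: aw.
Qed.

(** Once the value of one die is fixed, a match becomes a prescription of all dice of the set, to
    which independence applies directly. *)
Lemma match_event_value j m :
  match_event Z j.+1 `&` Z j ord0 @^-1` [set m] =
  dice_values (roll_set j) (fun=> m).
Proof.
apply/seteqP; split => [w [/= Mw Zw] _ /mapP[l _ ->] /=|w vw].
  by rewrite (Mw l ord0).
have Zw l : Z j l w = m by apply: (vw (j, l)); rewrite map_f ?mem_enum.
by split=> [l l'|] /=; rewrite !Zw.
Qed.

Lemma measurable_match_event j : measurable (match_event Z j).
Proof.
case: j => [|j]; first exact: measurableT.
rewrite (_ : match_event _ _ = \bigcup_m dice_values (roll_set j) (fun=> m)).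
  by apply: bigcupT_measurable => m; exact: measurable_dice_values.
under eq_bigcupr do rewrite -match_event_value.
rewrite -setI_bigcupr; apply/esym/setIidPl => w _.
by exists (Z j ord0 w).
Qed.

Lemma measurable_all_match j : measurable (all_match j).
Proof.
by rewrite /all_match bigcap_mkord; apply: bigsetI_measurable => k _;
  exact: measurable_match_event.
Qed.

(* The fixed values on later sets of rolls make the induction on [j] work: a
   match in set [j] with common value [m] is absorbed into them. *)
Lemma probability_all_match j K v : uniq K ->
  (forall k, k \in K -> (j <= k.1)%N && (0 < v k <= s)%N) ->
  P (all_match j `&` dice_values K v) =
  ((s%:R^-1 ^+ n) ^+ j * s%:R^-1 ^+ size K)%:E.
Proof.
elim: j K v => [|j IHj] K v uK vK.
  rewrite all_match0 setTI probability_dice_values ?expr0 ?mul1r //.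
have mAK := measurableI _ _ (measurable_all_match j.+1)
  (measurable_dice_values K v).
rewrite (uniform_die_probability s_gt0 (proj2 fairZ j ord0) mAK).
have jK k : k \in K -> (k.1 == j) = false.
  by move=> /vK/andP[jk _]; apply/gtn_eqF.
(* Each common value [m.+1] prescribes [n.+1] further dice. Summing over the [s] values cancels one
   factor [1/s] and leaves one more factor [q]. *)
rewrite (eq_bigr (fun=> ((s%:R^-1 ^+ n) ^+ j * s%:R^-1 ^+ (n.+1 + size K))%:E)).
  rewrite sumEFin sumr_const card_ord; congr EFin.
  rewrite exprD !exprS -[LHS]mulr_natr.
  have s0 : s%:R != 0 :> R by rewrite pnatr_eq0 -lt0n.
  by field.
(* The dice in [K] belong to sets after [j], so [v'] prescribes the match in set [j] without
   changing [v] on [K]. *)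
move=> m _; pose v' k := if k.1 == j then m.+1 else v k.
rewrite (_ : _ `&` _ = all_match j `&` dice_values (roll_set j ++ K) v').
  rewrite IHj ?size_cat ?size_map -?enumT ?size_enum_ord //.
  - rewrite cat_uniq uK andbT map_inj_uniq ?enum_uniq; last by move=> ? ? [].
    apply/hasPn => k kK; apply/mapP => -[l _ kE].
    by have := jK k kK; rewrite kE eqxx.
  - move=> k; rewrite mem_cat => /orP[/mapP[l _ ->]|kK].
      by rewrite /v' /= eqxx leqnn /=.
    by rewrite /v' jK //; have /andP[/ltnW-> ->] := vK k kK.
rewrite all_matchS dice_values_cat (@eq_dice_values K v' v); last first.
  by move=> k kK; rewrite /v' jK.
rewrite (@eq_dice_values (roll_set j) v' (fun=> m.+1)); last first.
  by move=> _ /mapP[l _ ->]; rewrite /v' eqxx.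
by rewrite -match_event_value -!setIA (setIC (dice_values K v)).
Qed.

(** * Expected contribution of one set of rolls *)

Definition increment (j : nat) (w : T) : R :=
  \sum_(l < n.+1) \1_(all_match j) w * (Z j l w)%:R.

Lemma increment_ge0 j w : 0 <= increment j w.
Proof. by apply: sumr_ge0 => l _; rewrite mulr_ge0. Qed.

Lemma partial_outcomeE j w :
  (partial_outcome Z j w)%:R = \sum_(0 <= i < j) increment i w.
Proof.
elim: j => [|j IHj]; first by rewrite big_nil.
rewrite big_nat_recr //= -IHj /increment -mulr_sumr indicE -/(all_match j).
case: ifP => _; last by rewrite mul0r addr0.
by rewrite natrD natr_sum mul1r.
Qed.

Lemma measurable_masked_die j l :
  measurable_fun setT
    (fun w => (\1_(all_match j) w * (Z j l w)%:R)%:E : \bar R).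
Proof.
apply/measurable_EFinP/measurable_funM.
  exact/measurable_indic/measurable_all_match.
by apply: (@measurableT_comp _ _ _ _ _ _ (fun k : nat => k%:R : R)).
Qed.

(** [all_match j] constrains only the sets [Z i] with [i < j], so it is independent of [Z j l]: the
    result is [q^j] times the mean of [1], ..., [s]. *)
Lemma integral_masked_die j l :
  (\int[P]_w (\1_(all_match j) w * (Z j l w)%:R)%:E =
   ((s%:R^-1 ^+ n) ^+ j * ((s.+1)%:R / 2))%:E)%E.
Proof.
rewrite (uniform_die_integral s_gt0 (proj2 fairZ j l)); first last.
- by move=> w; rewrite lee_fin mulr_ge0.
- exact: measurable_masked_die.
set a := (s%:R^-1 ^+ n) ^+ j.
rewrite (eq_bigr (fun m : 'I_s => (a / s%:R * m.+1%:R)%:E)); last first.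
  move=> m _.
  have mY := measurable_RV_preimage (Z j l) [set m.+1].
  have mA := measurable_all_match j.
  under eq_integral => w /set_mem /= -> do rewrite mulrC EFinM.
  rewrite ge0_integralZl_EFin //; last first.
    apply: measurable_funTS; apply/measurable_EFinP; exact: measurable_indic.
  rewrite integral_indic //.
  (* A one-die prescription brings the event into the form handled by [probability_all_match]. *)
  rewrite (_ : _ @^-1` _ = dice_values [:: (j, l)] (fun=> m.+1)); last first.
    apply/seteqP; split => [w Zw k|w]; first by rewrite inE => /eqP ->.
    by move=> vw; exact: (vw (j, l) (mem_head _ _)).
  rewrite [X in (_ * X)%E](_ : _ = (a * s%:R^-1 ^+ 1)%:E).
    by rewrite -EFinM expr1 mulrC.
  apply: probability_all_match => // k.
  by rewrite inE => /eqP ->; rewrite leqnn /=.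
rewrite sumEFin -mulr_sumr -natr_sum; congr EFin.
have -> : (\sum_(m < s) m.+1)%:R = s%:R * s.+1%:R / 2 :> R.
  elim: (s) => [|k IHk]; first by rewrite big_ord0 !mul0r.
  rewrite big_ord_recr /= natrD IHk -!natr1.
  by field.
have s0 : s%:R != 0 :> R by rewrite pnatr_eq0 -lt0n.
by field.
Qed.

Lemma integral_increment j :
  (\int[P]_w (increment j w)%:E =
   (geometric (n.+1%:R * (s.+1%:R / 2)) (s%:R^-1 ^+ n) j)%:E)%E.
Proof.
under eq_integral do rewrite -sumEFin.
rewrite ge0_integral_sum //; last first.
  by move=> l; exact: measurable_masked_die.
rewrite (eq_bigr _ (fun l _ => integral_masked_die j l)) sumEFin.
rewrite sumr_const card_ord; congr EFin.
by rewrite /geometric /= -[LHS]mulr_natr; ring.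
Qed.

Lemma expected_outcome_fair_dice : (0 < n)%N -> (1 < s)%N ->
  expected_outcome Z =
  (n.+1%:R * (s.+1%:R / 2) / (1 - s%:R^-1 ^+ n))%:E.
Proof.
move=> n0 s1; rewrite /expected_outcome.
(* As a series of nonnegative increments, the outcome can be integrated term by term, even where it
   is infinite. *)
have -> : final_outcome Z = fun w => (\sum_(0 <= j <oo) (increment j w)%:E)%E.
  apply/funext => w; congr (limn _); apply/funext => j.
  by rewrite partial_outcomeE sumEFin.
rewrite integral_nneseries //; first last.
- by move=> j w _; rewrite lee_fin increment_ge0.
- move=> j; under eq_fun do rewrite -sumEFin.
  by apply: emeasurable_sum => l; exact: measurable_masked_die.
apply: cvg_lim => //.
under eq_fun do under eq_bigr do rewrite integral_increment.
under eq_fun do rewrite sumEFin.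
apply: cvg_EFin; first by near=> k.
apply: cvg_geometric_series.
rewrite ger0_norm ?exprn_ge0 ?invr_ge0 //.
(* At least two dice and two sides make the ratio [q] less than 1. *)
by rewrite exprn_ilt1 ?invr_ge0 -?lt0n ?invf_lt1 ?ltr1n ?ltr0n.
Unshelve. all: by end_near.
Qed.

End match_and_add_over.

Theorem corollary2p6 (R : realType) :
  (forall (d : measure_display) (T : measurableType d) (P : probability T R)
      (Z : nat -> 'I_3 -> {RV P >-> nat}),
    fair_dice 6 Z -> expected_outcome Z = (54 / 5)%:E) /\
  (forall (d : measure_display) (T : measurableType d) (P : probability T R)
      (Z : nat -> 'I_2 -> {RV P >-> nat}),
    fair_dice 6 Z -> expected_outcome Z = (42 / 5)%:E).
Proof.
(* Three dice give [q = 1/36] and [(21/2) / (35/36)]; two dice give [q = 1/6] and [7 / (5/6)]. *)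
by split=> d T P Z fairZ;
  rewrite (expected_outcome_fair_dice _ fairZ) //; congr EFin; field.
Qed.
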